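(* Let $G$ be a connected simple graph with vertex set $\{1,\ldots,n\}$ and maximum degree $\varDelta$. Let $\boldsymbol b=(b_1,\ldots,b_n)\in\mathbb R^n$ and $0<\delta\le 1$ be such that $\sum_{j=1}^n b_j=0$ and $$\Bigl|\sum_{j\in U}b_j\Bigr|\le(1-\delta)\,|\partial_G U|\qquad\text{for any }U\subset V(G).$$ Then, for $n\ge 10$, the solution $\boldsymbol r=(r_1,\ldots,r_n)$ in positive reals of the system $$\sum_{k:jk\in G}\frac{r_j-r_k}{r_j+r_k}=b_j,\qquad 1\le j\le n,$$ is such that, for all $j$ and $k$, $$\Bigl|\log\frac{r_j}{r_k}\Bigr|\le\frac{35\,\varDelta}{\delta h(G)}\,\log\frac{n}{\delta h(G)}\,\log\frac1\delta.$$
   Context: $\partial_G U$ is the set of edges of $G$ with exactly one end in $U$; $jk\in G$ means $jk$ is an edge of $G$. The Cheeger constant is $h(G)=\min\{|\partial_G U|/|U| : U\subset V(G),\ 1\le |U|\le \frac12|V(G)|\}$. Under the stated hypotheses the system has a positive solution which is unique up to multiplication of $\boldsymbol r$ by a positive constant, so the ratios $r_j/r_k$ are well defined. *)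

(* Defs.v *)
From HB Require Import structures.
From mathcomp Require Import all_boot all_order all_algebra.
From mathcomp Require Import all_classical all_reals all_analysis.

Set Implicit Arguments.
Unset Strict Implicit.
Unset Printing Implicit Defensive.

Import Order.TTheory GRing.Theory Num.Theory.
Local Open Scope ring_scope.

Record sgraph (T : finType) := SGraph {
  adj :> rel T;
  adj_sym : symmetric adj;
  adj_irr : irreflexive adj
}.

Definition connected_graph (T : finType) (G : sgraph T) : Prop :=
  forall x y : T, connect G x y.

Definition degree (T : finType) (G : sgraph T) (x : T) : nat :=
  #|[set y | G x y]|.

Definition max_degree (T : finType) (G : sgraph T) : nat :=
  \max_(x : T) degree G x.

(* An edge is the unordered pair of its two ends. *)
Definition edges (T : finType) (G : sgraph T) : {set {set T}} :=
  [set [set p.1; p.2] | p in [set q : T * T | G q.1 q.2]].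

Definition edge_boundary (T : finType) (G : sgraph T) (U : {set T}) :
    {set {set T}} :=
  [set a in edges G | #|a :&: U| == 1%N].

Definition cheeger_admissible (T : finType) (U : {set T}) : bool :=
  (1 <= #|U|)%N && (2 * #|U| <= #|T|)%N.

Definition cheeger_ratio (R : realType) (T : finType) (G : sgraph T)
    (U : {set T}) : R :=
  #|edge_boundary G U|%:R / #|U|%:R.

(* The minimum of a finite set of reals, taken as its infimum; it is attained
   as soon as there are two vertices: see [cheeger_min]. *)
Definition cheeger (R : realType) (T : finType) (G : sgraph T) : R :=
  inf [set cheeger_ratio R G U | U in [set U | cheeger_admissible U]]%classic.

Lemma cheeger_min (R : realType) (T : finType) (G : sgraph T) :
  (1 < #|T|)%N ->
  (exists2 U : {set T}, cheeger_admissible U &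
     cheeger R G = cheeger_ratio R G U) /\
  (forall U : {set T}, cheeger_admissible U ->
     cheeger R G <= cheeger_ratio R G U).
Proof.
move=> T_gt1.
have /card_gt0P[x _] : (0 < #|T|)%N by apply: leq_trans T_gt1.
have adm1 : cheeger_admissible [set x].
  by rewrite /cheeger_admissible cards1 muln1.
case: (@arg_minP _ _ _ _ _ (cheeger_ratio R G) adm1) => U admU minU.
have lbU : lbound [set cheeger_ratio R G U | U in
    [set U | cheeger_admissible U]]%classic (cheeger_ratio R G U).
  by move=> _ [V /= admV <-]; exact: minU.
suff -> : cheeger R G = cheeger_ratio R G U by split=> //; exists U.
apply/eqP; rewrite eq_le; apply/andP; split.
  by apply: ge_inf; [exists (cheeger_ratio R G U) | exists U].
by apply: lb_le_inf => //; exists (cheeger_ratio R G U); exists U.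
Qed.

(* Main.v *)
(* Let U be a superlevel set of r with at most half of the vertices.  Summing
   the equations over U leaves only the boundary edges, on which
   (r_j - r_k) / (r_j + r_k) is nonnegative and has mean at most 1 - delta.  By
   Markov's inequality with threshold 1 - delta^2, at least a fraction
   s = delta / (1 + delta) of them end at a vertex with r_k >= delta^4 r_j.
   There are at least s h |U| such edges, and an outer vertex receives at most
   min(Delta, |U|) of them: lowering the level by the factor delta^4 adds
   s h |U| / min(Delta, |U|) vertices.  So the first step reaches s h vertices,
   each further one multiplies their number by 1 + s h / Delta, and about
   ln (n / (delta h)) / ln (1 + s h / Delta) steps exceed n / 2.  Doing the same
   for 1 / r, the sets grown from both ends meet.  The constant 35 needs
   h <= 3 Delta / 5, obtained by averaging the boundary over all sets of size
   n / 2. *)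

Require Import Defs.
From HB Require Import structures.
From mathcomp Require Import all_boot all_order all_algebra.
From mathcomp Require Import all_classical all_reals all_analysis.
From mathcomp Require Import ring lra zify.

Set Implicit Arguments.
Unset Strict Implicit.
Unset Printing Implicit Defensive.

Import Order.TTheory GRing.Theory Num.Theory.
Local Open Scope ring_scope.

(** * A lower bound for the logarithm *)

(** The difference of the two sides vanishes at 0 and has the nonnegative derivative
    [c ^+ 2 / ((1 + c) * (2 + c) ^+ 2)]. For [y > 0] this means 1 / ln (1 + y) <= 1 / y + 1 / 2,
    which later bounds the number of steps. *)
Lemma ln1D_ge (R : realType) (y : R) : 0 <= y -> 2 * y / (2 + y) <= ln (1 + y).
Proof.
move=> y0; pose f (x : R) := ln (1 + x) - (2 - 4 * (2 + x)^-1).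
pose df (x : R) := (1 + x)^-1 - 4 * (2 + x) ^- 2.
have fE (x : R) : 0 <= x -> is_derive x 1 f (df x).
  move=> x0.
  have x1 : 0 < 1 + x by lra.
  have x2 : 2 + x != 0 by apply: lt0r_neq0; lra.
  have dl := @is_derive1_ln R (1 + x) x1.
  apply: is_derive_eq.
  rewrite /df /GRing.scale /= ; field.
  by rewrite x2 lt0r_neq0.
have cf : {within `[0, y], continuous f}%classic.
  apply: continuous_in_subspaceT => x; rewrite inE /= in_itv /= => /andP[x0 _].
  apply: differentiable_continuous; apply/derivable1_diffP.
  by have [] := fE x x0.
have fE' x : x \in `]0, y[ -> is_derive x 1 f (df x).
  by rewrite in_itv /= => /andP[x0 _]; apply: fE; exact: ltW.
have [c] := MVT_segment y0 fE' cf.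
rewrite in_itv /= => /andP[c0 _] fy.
have : 0 <= f y - f 0.
  rewrite fy subr0 mulr_ge0 // /df.
  have -> : (1 + c)^-1 - 4 * (2 + c) ^- 2 = c ^+ 2 / ((1 + c) * (2 + c) ^+ 2).
    field; apply/andP; split; apply: lt0r_neq0; lra.
  by rewrite divr_ge0 ?mulr_ge0 ?sqr_ge0 //; lra.
have -> : 2 * y / (2 + y) = 2 - 4 * (2 + y)^-1.
  by field; apply: lt0r_neq0; lra.
rewrite /f !addr0 ln1; lra.
Qed.

(** * Cuts and the Cheeger constant *)

(** Boundary edges are oriented outwards, so that the antisymmetric [slope] can be summed over
    them. *)
Definition cut (T : finType) (G : sgraph T) (U : {set T}) : {set T * T} :=
  [set p | [&& p.1 \in U, p.2 \notin U & G p.1 p.2]].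

(** Forgetting the orientation covers the boundary. This carries both the Cheeger bound and the
    bound on [b] over to cuts. *)
Lemma edge_boundary_le_cut (T : finType) (G : sgraph T) (U : {set T}) :
  (#|edge_boundary G U| <= #|cut G U|)%N.
Proof.
apply: leq_trans (leq_imset_card (fun p : T * T => [set p.1; p.2]) _).
apply: subset_leq_card; apply/fintype.subsetP => e.
rewrite inE => /andP[/imsetP[[x y] /=]].
rewrite inE /= => Gxy -> card1.
have nxy : x != y by apply: contraTneq Gxy => ->; rewrite adj_irr.
move: card1.
have [xU|xU] := boolP (x \in U); have [yU|yU] := boolP (y \in U).
- have /finset.setIidPl -> : [set x; y] \subset U.
    by rewrite finset.subUset !finset.sub1set xU yU.
  by rewrite cards2 nxy.
- move=> _; apply/imsetP; exists (x, y) => //; first by rewrite inE /= xU yU.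
- move=> _; apply/imsetP; exists (y, x); last by rewrite /= finset.setUC.
  by rewrite inE /= xU yU adj_sym.
- have -> : [set x; y] :&: U = finset.set0; last by rewrite cards0.
  apply/setP => z; rewrite !inE.
  case: eqP => [->|_]; first by rewrite (negbTE xU).
  by case: eqP => [->|]//; rewrite (negbTE yU).
Qed.

(** With an empty boundary [U] would be closed under adjacency, against connectedness. *)
Lemma edge_boundary_gt0 (T : finType) (G : sgraph T) (U : {set T}) (x y : T) :
  connected_graph G -> x \in U -> y \notin U -> (0 < #|edge_boundary G U|)%N.
Proof.
move=> Gc xU yU; rewrite lt0n; apply/negP => /eqP/cards0_eq e0.
suff Ucl : fingraph.closed G [pred z in U].
  by move: (closed_connect Ucl (Gc x y)); rewrite !inE xU (negbTE yU).
have noedge u v : G u v -> u \in U -> v \notin U -> False.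
  move=> Guv uU vU; have : [set u; v] \in edge_boundary G U.
    rewrite inE; apply/andP; split.
      by apply/imsetP; exists (u, v); rewrite ?inE.
    have -> : [set u; v] :&: U = [set u]; last by rewrite cards1.
    apply/setP => z; rewrite !inE; case: eqP => [->|_] //=.
    by case: eqP => [->|]//=; rewrite (negbTE vU).
  by rewrite e0 inE.
move=> u v Guv; rewrite !inE; apply/idP/idP => H; apply/negPn/negP => H'.
  exact: noedge H H'.
by apply: noedge H H'; rewrite adj_sym.
Qed.

Lemma cheeger_gt0 (R : realType) (T : finType) (G : sgraph T) :
  (1 < #|T|)%N -> connected_graph G -> 0 < cheeger R G.
Proof.
move=> T1 Gc; have [[U /andP[U1 U2] ->] _] := cheeger_min R G T1.
have /card_gt0P[x xU] : (0 < #|U|)%N by [].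
have /card_gt0P[y] : (0 < #|~: U|)%N by have := cardsC U; lia.
rewrite inE => yU.
by rewrite divr_gt0 // ltr0n // (edge_boundary_gt0 Gc xU yU).
Qed.

Lemma cheeger_cut (R : realType) (T : finType) (G : sgraph T) (U : {set T}) :
  (1 < #|T|)%N -> cheeger_admissible U ->
  cheeger R G * #|U|%:R <= #|cut G U|%:R.
Proof.
move=> T1 admU; have [_ /(_ U admU)] := cheeger_min R G T1.
rewrite /cheeger_ratio ler_pdivlMr ?ltr0n; last by case/andP: admU.
move=> /le_trans; apply; rewrite ler_nat; exact: edge_boundary_le_cut.
Qed.

Lemma degree_le_max (T : finType) (G : sgraph T) (x : T) :
  (degree G x <= max_degree G)%N.
Proof. exact: (leq_bigmax x). Qed.

Lemma max_degree_lt (T : finType) (G : sgraph T) :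
  (0 < #|T|)%N -> (max_degree G < #|T|)%N.
Proof.
move=> T0; rewrite -(prednK T0) ltnS; apply/bigmax_leqP => x _.
rewrite -ltnS (prednK T0) /degree -cardsT; apply: proper_card.
apply/properP; split; first exact: finset.subsetT.
by exists x; rewrite ?inE ?adj_irr.
Qed.

(** * Averaging cuts over all sets of a given size *)

(** [U] is recovered from [U :\ x], a [k]-subset of the complement of [[set x; y]]. *)
Lemma card_separating_sets (T : finType) (x y : T) (k : nat) : x != y ->
  (#|[set U : {set T} | [&& #|U| == k.+1, x \in U & y \notin U]]|
     <= 'C(#|T|.-2, k))%N.
Proof.
move=> xy; have <- : #|~: [set x; y]| = #|T|.-2.
  by have := cardsC [set x; y]; rewrite cards2 xy; lia.
rewrite -cards_draws.
apply: leq_trans (leq_imset_card (fun A : {set T} => x |: A) _).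
apply: subset_leq_card; apply/fintype.subsetP => U.
rewrite inE => /and3P[/eqP cU xU yU]; apply/imsetP; exists (U :\ x).
  rewrite inE; apply/andP; split; last by move: cU; rewrite (cardsD1 x) xU; lia.
  apply/fintype.subsetP => z; rewrite !inE => /andP[zx zU].
  by rewrite (negbTE zx) /=; apply: contraNneq yU => <-.
by rewrite finset.setD1K.
Qed.

(** Double counting: there are at most [#|T| * max_degree G] ordered adjacent pairs, and each lies
    in the cuts of at most ['C(#|T|.-2, k)] of the sets. *)
Lemma sum_card_cut_le (T : finType) (G : sgraph T) (k : nat) :
  (\sum_(U : {set T} | #|U| == k.+1) #|cut G U|
     <= #|T| * max_degree G * 'C(#|T|.-2, k))%N.
Proof.
under eq_bigr do rewrite -sum1_card.
rewrite (exchange_big_dep (fun p : T * T => G p.1 p.2)) /=; last first.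
  by move=> U p _; rewrite inE => /and3P[].
apply: leq_trans (_ : \sum_(x : T) \sum_(y | G x y)
    \sum_(U : {set T} | (#|U| == k.+1) && ((x, y) \in cut G U)) 1 <= _)%N.
  rewrite [X in (_ <= X)%N]pair_big_dep /=.
  by apply: eq_leq; apply: eq_big => -[x y].
have -> : (#|T| * max_degree G * 'C(#|T|.-2, k) =
           \sum_(x : T) max_degree G * 'C(#|T|.-2, k))%N.
  by rewrite sum_nat_const mulnA.
apply: leq_sum => x _.
apply: leq_trans (_ : degree G x * 'C(#|T|.-2, k) <= _)%N; last first.
  by rewrite leq_mul2r degree_le_max orbT.
rewrite /degree cardsE -sum_nat_const; apply: leq_sum => y Gxy.
rewrite sum1dep_card; apply: leq_trans (card_separating_sets k (_ : x != y)).
  apply: subset_leq_card; apply/fintype.subsetP => U; rewrite !inE /=.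
  by case/and3P=> -> -> /andP[-> _].
by apply: contraTneq (Gxy : G x y) => ->; rewrite adj_irr.
Qed.

(* The average of [#|cut G U| / #|U|] over the sets [U] of size [k.+1]. *)
Lemma cheeger_max_degree (R : realType) (T : finType) (G : sgraph T) (k : nat) :
  (1 < #|T|)%N -> (2 * k.+1 <= #|T|)%N ->
  cheeger R G * (#|T|.-1)%:R <= (max_degree G * (#|T| - k.+1))%:R.
Proof.
move=> T1 kT; set n := #|T| in T1 kT *; set D := max_degree G.
have C0 : (0 < 'C(n, k.+1))%N by rewrite bin_gt0; lia.
have avg : cheeger R G * (k.+1 * 'C(n, k.+1))%:R <= (n * D * 'C(n.-2, k))%:R.
  have <- : #|[pred U : {set T} | #|U| == k.+1]| = 'C(n, k.+1).
    by rewrite -card_draws cardsE.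
  rewrite natrM mulrA mulr_natr -sumr_const.
  apply: le_trans (_ : (\sum_(U : {set T} | #|U| == k.+1) #|cut G U|)%:R <= _).
    rewrite natr_sum; apply: ler_sum => U /eqP cU; rewrite -cU cheeger_cut //.
    by rewrite /cheeger_admissible cU.
  by rewrite ler_nat sum_card_cut_le.
(* These two identities reduce the quotient of the binomial expressions in [avg] to
   [D * (n - k.+1) / n.-1]. *)
have id1 : (n * 'C(n.-1, k) = k.+1 * 'C(n, k.+1))%N by exact: mul_bin_diag.
have id2 : (n.-1 * 'C(n.-2, k) = (n.-1 - k) * 'C(n.-1, k))%N.
  exact: mul_bin_down.
have kC : 0 < (k.+1 * 'C(n, k.+1))%:R :> R by rewrite ltr0n; lia.
rewrite -(ler_pM2r kC) mulrAC.
apply: le_trans (ler_wpM2r (ler0n _ _) avg) _.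
rewrite -!natrM ler_nat -id1.
have -> : (n - k.+1 = n.-1 - k)%N by lia.
have -> : (n * D * 'C(n.-2, k) * n.-1 = n * D * (n.-1 * 'C(n.-2, k)))%N by ring.
rewrite id2; lia.
Qed.

(** * Flow through a cut and growth of superlevel sets *)

(** Edges inside [U] are counted in both orientations and cancel. *)
Lemma sum_antisym_cut (R : realType) (T : finType) (G : sgraph T)
    (t : T -> T -> R) (U : {set T}) :
  (forall j k, t j k = - t k j) ->
  \sum_(j in U) \sum_(k | G j k) t j k = \sum_(p in cut G U) t p.1 p.2.
Proof.
move=> tN.
have int0 : \sum_(j in U) \sum_(k | G j k && (k \in U)) t j k = 0.
  set s := LHS; suff : s = - s by lra.
  rewrite {1}/s (exchange_big_dep (mem U)) /=; last by move=> j k _ /andP[].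
  rewrite /s -sumrN; apply: eq_bigr => j jU; rewrite -sumrN.
  apply: eq_big => [k|k _]; last exact: tN.
  by rewrite jU andbT andbC adj_sym.
transitivity (\sum_(j in U) \sum_(k | G j k && (k \notin U)) t j k).
  rewrite -[RHS]add0r -[X in _ = X + _]int0 -big_split /=.
  by apply: eq_bigr => j _; rewrite (bigID (mem U)).
rewrite pair_big_dep /=; apply: eq_bigl => p.
by rewrite inE andbCA andbC -!andbA andbC -andbA.
Qed.

(** Grouped by outer end: a vertex of [W :\: U] receives at most as many edges as its degree, and at
    most one from each vertex of [U]. *)
Lemma card_cut_into (T : finType) (G : sgraph T) (U W : {set T}) :
  (#|[set p in cut G U | p.2 \in W]|
     <= #|W :\: U| * minn (max_degree G) #|U|)%N.
Proof.
rewrite -sum1dep_card.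
rewrite (eq_bigl (fun p => (p.2 \in W :\: U) && ((p.1 \in U) && G p.1 p.2)));
  last first.
  move=> p; rewrite !inE.
  by case: (p.1 \in U); case: (p.2 \in U); case: (G _ _); case: (p.2 \in W).
rewrite (reindex (fun q : T * T => (q.2, q.1))) /=; last first.
  by exists (fun q : T * T => (q.2, q.1)) => -[].
rewrite -(pair_big_dep (fun k => k \in W :\: U) (fun k j => (j \in U) && G j k)
   (fun _ _ => 1%N)) /=.
rewrite -sum_nat_const; apply: leq_sum => k _; rewrite sum1dep_card leq_min.
apply/andP; split.
  apply: leq_trans (degree_le_max G k); apply: subset_leq_card.
  by apply/fintype.subsetP => j; rewrite !inE adj_sym => /andP[].
by apply: subset_leq_card; apply/fintype.subsetP => j; rewrite !inE => /andP[].
Qed.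

Definition slope (R : realType) (T : Type) (r : T -> R) (j k : T) : R :=
  (r j - r k) / (r j + r k).

Definition superlevel (R : realType) (T : finType) (r : T -> R) (a : R) :
    {set T} := [set j | a <= r j].

(** The conclusion amounts to (2 - d^2) y < d^2 x. It follows from y < d^4 x because (2 - d^2) d^2
    <= 1, that is, (1 - d^2)^2 >= 0; hence the exponent 4. *)
Lemma slope_gt (R : realType) (x y d : R) :
  0 < y -> 0 < d -> d <= 1 -> y < d ^+ 4 * x ->
  (1 - d) * (1 + d) < (x - y) / (x + y).
Proof.
move=> y0 d0 d1 yx.
have d4 : d ^+ 4 <= 1 by rewrite exprn_ile1 // ltW.
have d40 : 0 < d ^+ 4 by rewrite exprn_gt0.
have x0 : 0 < x by rewrite -(pmulr_rgt0 _ d40); apply: lt_trans yx.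
rewrite ltr_pdivlMr ?addr_gt0 //.
have q1 : 0 < d ^+ 2 by rewrite exprn_gt0.
have q2 : d ^+ 2 <= 1 by rewrite exprn_ile1 // ltW.
have -> : (1 - d) * (1 + d) = 1 - d ^+ 2 by ring.
have : (2 - d ^+ 2) * y < (2 - d ^+ 2) * (d ^+ 4 * x).
  by rewrite ltr_pM2l //; lra.
have : (2 - d ^+ 2) * (d ^+ 4 * x) <= d ^+ 2 * x.
  rewrite mulrA ler_pM2r //.
  have -> : d ^+ 4 = d ^+ 2 * d ^+ 2 by ring.
  have := mulr_ge0 (ltW q1) (sqr_ge0 (1 - d ^+ 2)); lra.
lra.
Qed.

(* Markov's inequality with the threshold [(1 - d) * (1 + d)]: the mean slope
   over the cut is at most [1 - d], so at most a fraction [1 / (1 + d)] of its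
   edges has a slope above the threshold. *)
Lemma superlevel_short_edges (R : realType) (T : finType) (G : sgraph T)
    (r : T -> R) (d a : R) :
  (forall j, 0 < r j) -> 0 < d -> d <= 1 -> 0 <= a ->
  \sum_(p in cut G (superlevel r a)) slope r p.1 p.2
    <= (1 - d) * #|cut G (superlevel r a)|%:R ->
  d * #|cut G (superlevel r a)|%:R <= (1 + d) *
    #|[set p in cut G (superlevel r a) | p.2 \in superlevel r (d ^+ 4 * a)]|%:R.
Proof.
move=> r0 d0 d1 a0; set U := superlevel r a; set W := superlevel r _ => flow.
set S := [set p in cut G U | _].
pose L := [set p in cut G U | p.2 \notin W].
have SL : (#|S| + #|L| = #|cut G U|)%N.
  rewrite -(cardsID [set p : T * T | p.2 \in W] (cut G U)).
  by congr (_ + _)%N; apply: eq_card => p; rewrite !inE // andbC.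
have pos p : p \in cut G U -> 0 <= slope r p.1 p.2.
  rewrite !inE => /and3P[p1 p2 _]; rewrite divr_ge0 //; last first.
    by rewrite addr_ge0 // ltW.
  by rewrite subr_ge0; apply: le_trans p1; apply: ltW; rewrite ltNge.
have long p : p \in L -> (1 - d) * (1 + d) < slope r p.1 p.2.
  rewrite !inE => /andP[/and3P[p1 _ _]]; rewrite -ltNge => p2.
  apply: slope_gt => //; apply: lt_le_trans p2 _.
  by rewrite ler_pM2l // exprn_gt0.
have sumL : \sum_(p in L) slope r p.1 p.2 <= (1 - d) * #|cut G U|%:R.
  apply: le_trans flow; rewrite [leRHS](bigID (mem L)) /=.
  rewrite [X in _ <= X + _](eq_bigl (mem L)) ?lerDl.
    by apply: sumr_ge0 => p /andP[/pos].
  by move=> p /=; rewrite -topredE /= inE andbA andbb.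
rewrite -SL natrD in sumL *.
have [L0|/set0Pn[p0 p0L]] := eqVneq L finset.set0.
  by rewrite L0 cards0 addr0 ler_wpM2r // lerDr.
have : \sum_(p in L) (1 - d) * (1 + d) < \sum_(p in L) slope r p.1 p.2.
  by apply: ltr_sum => //; apply/hasP; exists p0; rewrite ?mem_index_enum.
rewrite sumr_const -mulr_natl => /lt_le_trans/(_ sumL) lt.
(* As [1 - d] is nonnegative, strictness forces [d * #|L| < #|S|], and adding [d * #|S|] gives the
   claim. For [d = 1] it is a contradiction: no edge can be long. *)
have : 0 < (1 - d) * (#|S|%:R - d * #|L|%:R) by lra.
nra.
Qed.

(** With s = d / (1 + d), the chain is s h |U| <= s |cut U| <= number of short edges <= |V \ U|
    min(Delta, |U|), where V is the lower superlevel set. *)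
Lemma superlevel_growth (R : realType) (T : finType) (G : sgraph T)
    (r : T -> R) (d a : R) :
  (1 < #|T|)%N -> (forall j, 0 < r j) -> 0 < d -> d <= 1 -> 0 <= a ->
  \sum_(p in cut G (superlevel r a)) slope r p.1 p.2
    <= (1 - d) * #|cut G (superlevel r a)|%:R ->
  cheeger_admissible (superlevel r a) ->
  d / (1 + d) * cheeger R G * #|superlevel r a|%:R <=
    (#|superlevel r (d ^+ 4 * a)|%:R - #|superlevel r a|%:R)
    * (minn (max_degree G) #|superlevel r a|)%:R.
Proof.
move=> T1 r0 d0 d1 a0 flow adm.
have short := superlevel_short_edges r0 d0 d1 a0 flow.
have chg := cheeger_cut R G T1 adm.
set U := superlevel r a in short chg *; set V := superlevel r _ in short *.
have UV : U \subset V.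
  apply/fintype.subsetP => j; rewrite !inE; apply: le_trans.
  by rewrite ler_piMl // exprn_ile1 // ltW.
have -> : #|V|%:R - #|U|%:R = #|V :\: U|%:R :> R.
  by rewrite -(cardsID U V) (finset.setIidPr UV) natrD addrAC subrr add0r.
have := card_cut_into G U V; rewrite -(ler_nat R) natrM.
apply: le_trans.
have d1p : 0 < 1 + d by lra.
rewrite -mulrA mulrAC ler_pdivrMr // [leRHS]mulrC.
by apply: le_trans short; rewrite ler_pM2l.
Qed.

Lemma superlevel_iter (R : realType) (T : finType) (G : sgraph T)
    (r : T -> R) (d : R) (j : T) (m : nat) :
  (1 < #|T|)%N -> (0 < max_degree G)%N ->
  (forall j, 0 < r j) -> 0 < d -> d <= 1 ->
  (forall U : {set T},
    \sum_(p in cut G U) slope r p.1 p.2 <= (1 - d) * #|cut G U|%:R) ->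
  0 <= cheeger R G ->
  #|T|%:R < 2 * (d / (1 + d) * cheeger R G *
     (1 + d / (1 + d) * cheeger R G / (max_degree G)%:R) ^+ m) ->
  (#|T| < 2 * #|superlevel r (d ^+ (4 * m.+1) * r j)|)%N.
Proof.
move=> T1 D0 r0 d0 d1 flow h0.
set D := max_degree G in D0 *; set sh := d / (1 + d) * cheeger R G.
have sh0 : 0 <= sh by rewrite mulr_ge0 // divr_ge0; lra.
pose S i := superlevel r (d ^+ (4 * i) * r j).
have S0 i : (0 < #|S i|)%N.
  apply/card_gt0P; exists j; rewrite inE ler_piMl ?exprn_ile1 //; exact: ltW.
have step i : (2 * #|S i| <= #|T|)%N ->
    sh * #|S i|%:R <= (#|S i.+1|%:R - #|S i|%:R) * (minn D #|S i|)%:R.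
  move=> Si; rewrite /S mulnS exprD -mulrA; apply: superlevel_growth => //.
    by rewrite mulr_ge0 ?exprn_ge0 // ltW.
  by rewrite /cheeger_admissible -/(S i) S0.
have step_mono i : (#|S i| <= #|S i.+1|)%N.
  apply: subset_leq_card; apply/fintype.subsetP => k; rewrite !inE.
  apply: le_trans; rewrite ler_pM2r // mulnS exprD ler_piMl ?exprn_ile1 //.
    by rewrite exprn_ge0 // ltW.
  exact: ltW.
have Dp : 0 < D%:R :> R by rewrite ltr0n.
(* Growth is guaranteed only up to half of the vertices, hence the disjunction. The exponent lags
   the index by one, as the first step only reaches [sh]. *)
suff iter k : (#|T| < 2 * #|S k.+1|)%N \/
    sh * (1 + sh / D%:R) ^+ k <= #|S k.+1|%:R.
  case: (iter m) => // le; rewrite -/(S _) -(ltr_nat R) natrM => lt.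
  by apply: lt_le_trans lt _; rewrite ler_pM2l.
elim: k => [|k [IH|IH]]; last 2 first.
- by left; apply: leq_trans IH _; rewrite leq_mul2l step_mono.
- have [big|small] := ltnP #|T| (2 * #|S k.+1|).
    by left; apply: leq_trans big _; rewrite leq_mul2l step_mono.
  right; rewrite exprSr mulrA.
  apply: le_trans (_ : #|S k.+1|%:R * (1 + sh / D%:R) <= _).
    by rewrite ler_wpM2r // addr_ge0 // divr_ge0 // ltW.
  rewrite mulrDr mulr1 -lerBrDl mulrA ler_pdivrMr // mulrC.
  apply: le_trans (step _ small) _; rewrite ler_wpM2l ?ler_nat ?geq_minl //.
  by rewrite subr_ge0 ler_nat step_mono.
have [big|small] := ltnP #|T| (2 * #|S 0|).
  by left; apply: leq_trans big _; rewrite leq_mul2l step_mono.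
(* Here [minn] is bounded by [#|S 0|], which then cancels; the later steps bound it by [D]. *)
right; rewrite expr0 mulr1.
have S0p : 0 < #|S 0|%:R :> R by rewrite ltr0n.
rewrite -(ler_pM2r S0p); apply: le_trans (step _ small) _.
apply: ler_pM => //; rewrite ?subr_ge0 ?ler_nat ?step_mono ?geq_minr //.
by rewrite lerBlDr lerDl.
Qed.

(** * Counting the steps, joining the two ends, and the constants *)

Lemma max_degree_gt0 (T : finType) (G : sgraph T) :
  (1 < #|T|)%N -> connected_graph G -> (0 < max_degree G)%N.
Proof.
move=> T1 Gc; have /card_gt0P[x _] : (0 < #|T|)%N by lia.
have /card_gt0P[y] : (0 < #|~: [set x]|)%N.
  by have := cardsC [set x]; rewrite cards1; lia.
rewrite inE => yx.
have := edge_boundary_gt0 Gc (set11 x) yx.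
move=> /leq_trans/(_ (edge_boundary_le_cut _ _)) /card_gt0P[[u v]].
rewrite inE /= => /and3P[_ _ Guv]; apply: leq_trans (degree_le_max G u).
by apply/card_gt0P; exists v; rewrite inE.
Qed.

(* Here [z = Delta / (delta * h)], [L = ln (n / (delta * h))] and
   [lam = ln (1 / delta)]; there are [m.+1] steps from each end, each costing
   [4 * lam]. *)
Lemma step_count (R : realType) (z d L lam : R) (m : nat) :
  0 < d -> d <= 1 -> 5 <= 3 * z -> 10 <= 17 * L -> 0 <= lam ->
  m%:R <= L / ln (1 + ((1 + d) * z)^-1) + 1 ->
  (8 * m.+1)%:R * lam <= 35 * z * L * lam.
Proof.
move=> d0 d1 z3 L17 lam0 mle; rewrite ler_wpM2r // natrM -[m.+1]addn1 natrD.
set y := ((1 + d) * z)^-1 in mle.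
have w0 : 0 < (1 + d) * z by apply: mulr_gt0; lra.
have y0 : 0 < y by rewrite invr_gt0.
have L0 : 0 < L by lra.
have lny := ln1D_ge (ltW y0).
have ypos : 0 < 2 * y / (2 + y) by rewrite divr_gt0 ?mulr_gt0 //; lra.
have : L / ln (1 + y) <= L * ((1 + d) * z + 2^-1).
  rewrite ler_pM2l // -[leRHS]invrK lef_pV2 ?posrE ?invr_gt0; last 2 first.
  - exact: lt_le_trans lny.
  - by rewrite addr_gt0.
  apply: le_trans lny; rewrite le_eqVlt; apply/orP; left; apply/eqP.
  rewrite /y; field; apply/and3P; split; apply: lt0r_neq0; nra.
(* In all, 8 (m + 1) <= 16 zL + 4 L + 16. By L <= (3/5) zL and 16 <= 27.2 L this is at most (16 +
   2.4 + 16.32) zL = 34.72 zL. *)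
have dzL : L * ((1 + d) * z) <= L * (2 * z).
  rewrite ler_pM2l // ler_wpM2r //; lra.
have : 5 * L <= 3 * z * L by rewrite ler_pM2r.
have -> : 35 * z * L = 35 * (z * L) by ring.
move: dzL; have -> : L * (2 * z) = 2 * (z * L) by ring.
rewrite mulrDr; lra.
Qed.

Lemma slopeN (R : realType) (T : Type) (r : T -> R) (j k : T) :
  slope r j k = - slope r k j.
Proof. by rewrite /slope [r k + r j]addrC -mulNr opprB. Qed.

Lemma slope_inv (R : realType) (T : Type) (r : T -> R) (j k : T) :
  (forall j, 0 < r j) -> slope (fun i => (r i)^-1) j k = - slope r j k.
Proof.
move=> r0; rewrite /slope; field.
by rewrite !lt0r_neq0 ?addr_gt0 ?r0 //.
Qed.

(** Two sets with more than half of the vertices share some [l], and both [r j / r l] and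
    [r l / r k] are at most [d ^- i]. *)
Lemma ln_ratio_le (R : realType) (T : finType)
    (r : T -> R) (d : R) (i : nat) (j k : T) :
  (forall j, 0 < r j) -> 0 < d ->
  (#|T| < 2 * #|superlevel r (d ^+ i * r j)|)%N ->
  (#|T| < 2 * #|superlevel (fun l => (r l)^-1) (d ^+ i * (r k)^-1)|)%N ->
  ln (r j / r k) <= (2 * i)%:R * ln (1 / d).
Proof.
move=> r0 d0; set A := superlevel _ _; set B := superlevel _ _ => cA cB.
have /card_gt0P[l] : (0 < #|A :&: B|)%N.
  have := cardsUI A B; have := subset_leq_card (finset.subsetT (A :|: B)).
  by rewrite cardsT; lia.
rewrite !inE => /andP[rj rk].
have di : 0 < d ^+ i by rewrite exprn_gt0.
have le_i x y : 0 < x -> 0 < y -> d ^+ i * x <= y ->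
    ln (x / y) <= i%:R * ln (1 / d).
  move=> x0 y0 xy; rewrite div1r mulr_natl -lnXn ?invr_gt0 //.
  rewrite ler_ln ?posrE ?divr_gt0 ?exprn_gt0 ?invr_gt0 //.
  by rewrite exprVn ler_pdivrMr // -ler_pdivrMl ?invr_gt0 // invrK.
have -> : r j / r k = (r j / r l) * ((r k)^-1 / (r l)^-1).
  by field; rewrite !lt0r_neq0.
rewrite lnM ?posrE ?divr_gt0 ?invr_gt0 // mul2n -addnn natrD mulrDl.
by rewrite lerD // le_i // invr_gt0.
Qed.

(** Averaging over sets of size floor(n/2), with q = ceil(n/2), leaves 5 q <= 3 (n - 1) and 11 q <=
    6 n to check. Both are equalities at n = 11, and the first fails at n = 9. *)
Lemma cheeger_bounds (R : realType) (T : finType) (G : sgraph T) :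
  (10 <= #|T|)%N ->
  5 * cheeger R G <= 3 * (max_degree G)%:R /\
  11 * cheeger R G <= 6 * #|T|%:R.
Proof.
move=> T10; set n := #|T|; set D := max_degree G.
have kT : (2 * (n./2.-1).+1 <= n)%N by lia.
have := cheeger_max_degree R G _ kT; rewrite -/n -/D => /(_ ltac:(lia)) le.
have Dn : (D <= n.-1)%N.
  by have := max_degree_lt G (_ : (0 < n)%N); rewrite -/n -/D; lia.
have n1 : 0 < (n.-1)%:R :> R by rewrite ltr0n; lia.
set q := (n - _)%N in le *.
have q5 : (5 * q <= 3 * n.-1)%N by rewrite /q; lia.
have q11 : (11 * q <= 6 * n)%N by rewrite /q; lia.
split; rewrite -(ler_pM2r n1) -!mulrA.
  apply: le_trans (ler_wpM2l (ler0n R 5) le) _.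
  by rewrite -!natrM ler_nat mulnCA [leqRHS]mulnCA leq_mul2l q5 orbT.
apply: le_trans (ler_wpM2l (ler0n R 11) le) _.
rewrite -!natrM ler_nat mulnCA [leqRHS]mulnA mulnC; exact: leq_mul.
Qed.

Lemma ln_ratio_bound (R : realType) (n : nat) (G : sgraph 'I_n)
    (b : 'I_n -> R) (d : R) (r : 'I_n -> R) :
  (10 <= n)%N -> connected_graph G -> 0 < d -> d <= 1 ->
  (forall U : {set 'I_n},
     `|\sum_(j in U) b j| <= (1 - d) * #|edge_boundary G U|%:R) ->
  (forall j, 0 < r j) ->
  (forall j, \sum_(k < n | G j k) slope r j k = b j) ->
  forall j k : 'I_n,
    ln (r j / r k) <=
      35%:R * (max_degree G)%:R / (d * cheeger R G)
      * ln (n%:R / (d * cheeger R G)) * ln (1 / d).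
Proof.
move=> n10 Gc d0 d1 bU r0 rb j k.
have T10 : (10 <= #|'I_n|)%N by rewrite card_ord.
have T1 : (1 < #|'I_n|)%N by lia.
have h0 := cheeger_gt0 R T1 Gc.
have D0 := max_degree_gt0 T1 Gc.
have [] := cheeger_bounds R G T10; rewrite card_ord.
have := superlevel_iter _ T1 D0.
have Dp : 0 < (max_degree G)%:R :> R by rewrite ltr0n.
set h := cheeger R G in h0 *; set D := (max_degree G)%:R in Dp *.
move=> iter hD hn.
have flow U : `|\sum_(p in cut G U) slope r p.1 p.2| <= (1 - d) * #|cut G U|%:R.
  rewrite -(sum_antisym_cut G U (slopeN r)).
  under eq_bigr do rewrite rb.
  apply: le_trans (bU U) _; apply: ler_wpM2l; first by rewrite subr_ge0.
  by rewrite ler_nat edge_boundary_le_cut.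
have dh0 : 0 < d * h by rewrite mulr_gt0.
set L := ln (n%:R / (d * h)); set lam := ln (1 / d); set z := D / (d * h).
have dhh : d * h <= h by rewrite ler_piMl // ltW.
have z3 : 5 <= 3 * z by rewrite mulrA ler_pdivlMr //; lra.
have n0 : 0 < n%:R :> R by rewrite ltr0n; lia.
(* Since [d <= 1] and [11 * h <= 6 * n], the argument of the logarithm is at least 11/6 = 1 + 5/6,
   and [ln1D_ge] at 5/6 gives 10/17. *)
have L17 : 10 <= 17 * L.
  have /ln1D_ge l56 : 0 <= 5 / 6 :> R by lra.
  have -> : 10 = 17 * (2 * (5 / 6) / (2 + 5 / 6)) :> R by field.
  rewrite ler_pM2l //; apply: le_trans l56 _.
  have p56 : 0 < 1 + 5 / 6 :> R by lra.
  rewrite ler_ln ?posrE ?divr_gt0 //.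
  rewrite ler_pdivlMr //; lra.
have lam0 : 0 <= lam by rewrite ln_ge0 // div1r invf_ge1.
set y := d / (1 + d) * h / D.
have yz : y = ((1 + d) * z)^-1.
  rewrite /y /z; field; rewrite !lt0r_neq0 //; lra.
have y0 : 0 < y.
  by rewrite divr_gt0 // mulr_gt0 // divr_gt0 //; lra.
have ln0 : 0 < ln (1 + y) by rewrite ln_gt0 // ltrDl.
(* The least integer exceeding the quotient: [(1 + y) ^+ m] passes [n%:R / (d * h)], at the cost of
   at most one extra step. *)
pose m := (Num.truncn (L / ln (1 + y))).+1.
have mle : m%:R <= L / ln (1 + y) + 1.
  rewrite /m -addn1 natrD lerD2r truncn_le divr_ge0 //; lra.
have mgt : n%:R < 2 * (d / (1 + d) * h * (1 + y) ^+ m).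
  have : n%:R / (d * h) < (1 + y) ^+ m.
    rewrite -ltr_ln ?posrE ?divr_gt0 ?exprn_gt0 ?addr_gt0 //.
    rewrite lnXn ?addr_gt0 // -[ln _ *+ _]mulr_natl -ltr_pdivrMr //.
    exact: truncnS_gt.
  have : 0 < (1 + y) ^+ m by rewrite exprn_gt0 ?addr_gt0.
  move: (_ ^+ m) => e e0; rewrite ltr_pdivrMr // => lt; apply: lt_le_trans lt _.
  (* The factor 2, due to aiming at only half of the vertices, absorbs [1 + d]. *)
  have -> : 2 * (d / (1 + d) * h * e) = e * (d * h) * (2 / (1 + d)) by ring.
  rewrite ler_peMr //; first by rewrite mulr_ge0 // ltW.
  rewrite ler_pdivlMr; lra.
have bound : ln (r j / r k) <= (2 * (4 * m.+1))%:R * lam.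
  apply: ln_ratio_le => //; apply: iter => //; rewrite ?card_ord ?ltW //.
  - by move=> U; apply: le_trans (flow U); exact: ler_norm.
  - by move=> l; rewrite invr_gt0.
  (* Inverting [r] negates every slope, so the absolute value in [flow] covers this case too. *)
  move=> U; apply: le_trans (flow U); rewrite -normrN -sumrN.
  apply: le_trans (ler_norm _); apply: ler_sum => p _; by rewrite slope_inv.
apply: le_trans bound _; rewrite mulnA -[35%:R * D / _]mulrA -/z.
by apply: (step_count d0 d1) => //; rewrite -yz.
Qed.

Theorem lemma8 (R : realType) (n : nat) (G : sgraph 'I_n)
    (b : 'I_n -> R) (delta : R) (r : 'I_n -> R) :
  (10 <= n)%N ->
  connected_graph G ->
  0 < delta -> delta <= 1 ->
  \sum_(j < n) b j = 0 ->
  (forall U : {set 'I_n},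
     `|\sum_(j in U) b j| <= (1 - delta) * #|edge_boundary G U|%:R) ->
  (forall j : 'I_n, 0 < r j) ->
  (forall j : 'I_n, \sum_(k < n | G j k) (r j - r k) / (r j + r k) = b j) ->
  forall j k : 'I_n,
    `|ln (r j / r k)| <=
      35%:R * (max_degree G)%:R / (delta * cheeger R G)
      * ln (n%:R / (delta * cheeger R G))
      * ln (1 / delta).

Proof.
move=> n10 Gc d0 d1 _ bU r0 rb j k.
rewrite ler_norml (ln_ratio_bound n10 Gc d0 d1 bU) // andbT lerNl.
rewrite -lnV ?posrE ?divr_gt0 // invf_div.
exact: (ln_ratio_bound n10 Gc d0 d1 bU).
Qed.
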